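(* Let $G$ be a group and $\mu\in L(G)$. Let $\eta \in L(\mu)$ and let $a_z$ be an $L$-point of $\mu$. Then, for all $g \in G$, \[ N(\eta)^{a_z}(g) = a \wedge N(\eta^{a_z})(g), \] where $N(\cdot)$ denotes the normalizer in $\mu$.
   Context: $L=\langle L,\le,\vee,\wedge\rangle$ is a completely distributive (complete) lattice with greatest element $1$ and least element $0$. An $L$-subset of $G$ is a function $G\to L$; $\eta\subseteq\mu$ means $\eta(x)\le\mu(x)$ for all $x\in G$; unions of $L$-subsets are pointwise suprema. An $L$-subset $\mu$ of $G$ is an $L$-subgroup of $G$ if $\mu(xy)\ge\mu(x)\wedge\mu(y)$ and $\mu(x^{-1})=\mu(x)$ for all $x,y\in G$; $L(G)$ is the set of $L$-subgroups of $G$. For $\mu\in L(G)$, $L(\mu)$ denotes the set of $\eta\in L(G)$ with $\eta\subseteq\mu$. For $a\in L$ and $z\in G$, the $L$-point $a_z$ is the $L$-subset with value $a$ at $z$ and $0$ elsewhere; it is an $L$-point of $\mu$ (written $a_z\in\mu$) if $\mu(z)\ge a$. For $\eta\in L(\mu)$ and $a_z\in\mu$, the conjugate of $\eta$ by $a_z$ is the $L$-subgroup $\eta^{a_z}$ of $\mu$ given by $\eta^{a_z}(x)=a\wedge\eta(zxz^{-1})$ for all $x\in G$. The set product of $L$-subsets is $(\mu\circ\eta)(x)=\bigvee_{x=yz}\{\mu(y)\wedge\eta(z)\}$; in particular $(a_x\circ\eta)(z)=a\wedge\eta(x^{-1}z)$ and $(\eta\circ a_x)(z)=a\wedge\eta(zx^{-1})$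 for $z\in G$. For $\eta\in L(\mu)$, the normalizer of $\eta$ in $\mu$ is the $L$-subgroup $N(\eta)=\bigcup\{a_x\in\mu\mid a_x\circ\eta=\eta\circ a_x\}$ of $\mu$, i.e. $N(\eta)(x)=\bigvee\{a\in L\mid a\le\mu(x),\ a_x\circ\eta=\eta\circ a_x\}$. *)

(* Defs.v *)
From mathcomp Require Import all_boot all_order.
From mathcomp Require Import boolp classical_sets.

Set Implicit Arguments.
Unset Strict Implicit.
Unset Printing Implicit Defensive.

Import Order.TTheory.

Local Open Scope classical_set_scope.
Local Open Scope group_scope.
Local Open Scope order_scope.

Section CompleteLattice.
Context {d : Order.disp_t} {L : tbLatticeType d}.
Implicit Types A : set L.

(* [supremum] and [infimum] return their first argument on the empty set, so
   the defaults are the values dictated by lattice theory. *)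
Definition lsup A : L := supremum \bot A.
Definition linf A : L := infimum \top A.

End CompleteLattice.

Definition complete_lattice {d : Order.disp_t} (L : tbLatticeType d) : Prop :=
  forall A : set L, supremums A !=set0 /\ infimums A !=set0.

Definition completely_distributive {d : Order.disp_t} (L : tbLatticeType d) :
    Prop :=
  forall (I : Type) (J : I -> Type) (u : forall i, J i -> L),
    linf [set lsup [set u i j | j in [set: J i]] | i in [set: I]] =
    lsup [set linf [set u i (f i) | i in [set: I]]
         | f in [set: forall i, J i]].

Section LSubgroups.
Context {d : Order.disp_t} {L : tbLatticeType d} {G : groupType}.
Implicit Types (mu eta nu : G -> L) (a : L) (x y z g : G).

Definition Lsubset eta mu : Prop := forall x, eta x <= mu x.

Definition Lunion (S : set (G -> L)) : G -> L :=
  fun x => lsup [set nu x | nu in S].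

Definition is_Lsubgroup mu : Prop :=
  (forall x y, mu x `&` mu y <= mu (x * y)%g) /\
  (forall x, mu (x^-1)%g = mu x).

Definition Lsubgroup_of mu eta : Prop := is_Lsubgroup eta /\ Lsubset eta mu.

Definition Lpoint a z : G -> L := fun x => if x == z then a else \bot.

Definition Lpoint_in a z mu : Prop := a <= mu z.

Definition Lconj eta a z : G -> L := fun x => a `&` eta (z * x * z^-1)%g.

Definition Lprod mu eta : G -> L :=
  fun x => lsup [set mu p.1 `&` eta p.2 | p in [set p | x = (p.1 * p.2)%g]].

Definition Lnormalizer mu eta : G -> L :=
  Lunion [set nu | exists a x, [/\ nu = Lpoint a x, Lpoint_in a x mu &
                                   Lprod nu eta = Lprod eta nu]].

End LSubgroups.

Section Facts.
Context {d : Order.disp_t} {L : tbLatticeType d} {G : groupType}.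
Context (cL : complete_lattice L).
Implicit Types (A : set L) (mu eta : G -> L) (a b : L) (x z : G).

Lemma lsup_ub A a : A a -> a <= lsup A.
Proof.
move=> Aa; have [[y yA] _] := cL A; rewrite /lsup /supremum ifF.
  by case: xgetP => [w _ [wA _]|/(_ y) //]; exact: wA.
by apply/negP => /eqP A0; rewrite A0 in Aa.
Qed.

Lemma lsup_le A b : (forall a, A a -> a <= b) -> lsup A <= b.
Proof.
move=> Ab; rewrite /lsup /supremum; case: ifPn => [_|_]; first exact: le0x.
by case: xgetP => [y _ [_ ]|_]; [apply|exact: le0x].
Qed.

Lemma linf_lb A a : A a -> linf A <= a.
Proof.
move=> Aa; have [_ [y yA]] := cL A; rewrite /linf /infimum ifF.
  by case: xgetP => [w _ [wA _]|/(_ y) //]; exact: wA.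
by apply/negP => /eqP A0; rewrite A0 in Aa.
Qed.

Lemma linf_ge A b : (forall a, A a -> b <= a) -> b <= linf A.
Proof.
move=> Ab; rewrite /linf /infimum; case: ifPn => [_|_]; first exact: lex1.
by case: xgetP => [y _ [_ ]|_]; [apply|exact: lex1].
Qed.

Lemma Lprod_Lpointl eta a x z :
  Lprod (Lpoint a x) eta z = a `&` eta (x^-1 * z)%g.
Proof.
apply/le_anti/andP; split.
  apply: lsup_le => _ [[y w] /= -> <-]; rewrite /Lpoint.
  by case: eqP => [->|_]; rewrite ?meet0x ?le0x // mulKg.
apply: lsup_ub; exists (x, x^-1 * z)%g; first by rewrite /= mulVKg.
by rewrite /Lpoint /= eqxx.
Qed.

Lemma Lprod_Lpointr eta a x z :
  Lprod eta (Lpoint a x) z = a `&` eta (z * x^-1)%g.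
Proof.
apply/le_anti/andP; split.
  apply: lsup_le => _ [[y w] /= -> <-]; rewrite /Lpoint.
  by case: eqP => [->|_]; rewrite ?meetx0 ?le0x // mulgK meetC.
apply: lsup_ub; exists (z * x^-1, x)%g; first by rewrite /= mulgVK.
by rewrite /Lpoint /= eqxx meetC.
Qed.

Lemma LnormalizerE mu eta x :
  Lnormalizer mu eta x =
  lsup [set a | a <= mu x /\ Lprod (Lpoint a x) eta = Lprod eta (Lpoint a x)].
Proof.
apply/le_anti/andP; split; apply: lsup_le.
  move=> _ [_ [a [y [-> ay ayE]]] <-]; rewrite {1}/Lpoint.
  by case: eqP => [->|_]; [exact: lsup_ub|exact: le0x].
move=> a [ax axE]; apply: lsup_ub; exists (Lpoint a x); first by exists a, x.
by rewrite /Lpoint eqxx.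
Qed.

Lemma Lconj_Lsubgroup mu eta a z :
  is_Lsubgroup mu -> Lsubgroup_of mu eta -> Lpoint_in a z mu ->
  Lsubgroup_of mu (Lconj eta a z).
Proof.
move=> [muM muV] [[etaM etaV] etamu] az; split; first split.
- move=> x y; rewrite /Lconj meetACA meetxx leI2 //.
  by apply: le_trans (etaM _ _) _; rewrite !mulgA mulgVK.
- by move=> x; rewrite /Lconj -[in RHS]etaV !invgM invgK !mulgA.
- move=> x; apply: (le_trans (leI2 az (etamu _))).
  have -> : x = (z^-1 * (z * x * z^-1) * z)%g by rewrite !mulgA mulVg mul1g mulgVK.
  set y := (z * x * z^-1)%g; have -> : (z * (z^-1 * y * z) * z^-1 = y)%g.
    by rewrite !mulgA mulgV mul1g mulgK.
  apply: le_trans (muM _ _); rewrite lexI leIl andbT.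
  by apply: le_trans (muM _ _); rewrite muV.
Qed.

End Facts.

(* Main.v *)
(* Membership of [b] in the set defining [N(eta)(w)] amounts to [b <= mu w] and
   [b /\ eta (w^-1 y) = b /\ eta (y w^-1)] for all [y].  Substituting
   [y := z y z^-1] shows that, with [w = z g z^-1], meeting with [a <= mu z]
   maps the set defining [N(eta)(z g z^-1)] into the one defining
   [N(eta^{a_z})(g)], and conversely.  Since binary meets distribute over
   arbitrary joins, the two sides dominate each other. *)
Require Import Defs.
From mathcomp Require Import all_boot all_order.
From mathcomp Require Import boolp classical_sets.

Set Implicit Arguments.
Unset Strict Implicit.
Unset Printing Implicit Defensive.

Import Order.TTheory.

Local Open Scope classical_set_scope.
Local Open Scope group_scope.
Local Open Scope order_scope.

(* Complete distributivity for a two-element index set: a singleton family with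
   value [a], and the family of the elements of [A]. *)
Lemma meet_lsup_le (d : Order.disp_t) (L : tbLatticeType d)
    (hL : complete_lattice L) (hcd : completely_distributive L)
    (A : set L) (a c : L) :
  (forall b, A b -> a `&` b <= c) -> a `&` lsup A <= c.
Proof.
move=> Ac.
pose J (i : bool) : Type := if i return Type then unit else {x : L | A x}.
pose u (i : bool) : J i -> L :=
  if i return J i -> L then fun=> a else fun x => sval x.
have le_inf : a `&` lsup A <=
    linf [set lsup [set @u i j | j in [set: J i]] | i in [set: bool]].
  apply: linf_ge => _ [[] _ <-].
    by apply: le_trans (leIl _ _) _; apply: (lsup_ub hL); exists tt.
  apply: le_trans (leIr _ _) _; apply: lsup_le => x Ax.
  by apply: (lsup_ub hL); exists (exist _ x Ax).
(* A choice function [f] selects a single member of [A], at index [false], so its infimum lies below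
   the meet of [a] with that member. *)
apply: (le_trans le_inf); rewrite hcd; apply: lsup_le => _ [f _ <-].
apply: le_trans (Ac _ (svalP (f false))); rewrite lexI; apply/andP; split.
  by apply: (linf_lb hL); exists true.
by apply: (linf_lb hL); exists false.
Qed.

Lemma meet_lsup_mono (d : Order.disp_t) (L : tbLatticeType d)
    (hL : complete_lattice L) (hcd : completely_distributive L)
    (A B : set L) (a : L) :
  (forall b, A b -> B (a `&` b)) -> a `&` lsup A <= a `&` lsup B.
Proof.
move=> AB; rewrite lexI leIl; apply: (meet_lsup_le hL hcd) => b /AB Bab.
exact: (lsup_ub hL).
Qed.

Lemma Lpoint_commP (d : Order.disp_t) (L : tbLatticeType d) (G : groupType)
    (hL : complete_lattice L) (eta : G -> L) (b : L) (x : G) :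
  Lprod (Lpoint b x) eta = Lprod eta (Lpoint b x) <->
  forall y, b `&` eta (x^-1 * y)%g = b `&` eta (y * x^-1)%g.
Proof.
split=> [E y|E].
  by rewrite -(Lprod_Lpointl hL) E (Lprod_Lpointr hL).
by apply/funext => y; rewrite (Lprod_Lpointl hL) (Lprod_Lpointr hL).
Qed.

(** Conjugation by [z] permutes [G], so the two pointwise criteria are reindexings of each other;
    the factor [a] of the conjugate moves into the height of the point. *)
Lemma Lpoint_comm_LconjP (d : Order.disp_t) (L : tbLatticeType d)
    (G : groupType) (hL : complete_lattice L) (eta : G -> L) (a b : L)
    (z g : G) :
  Lprod (Lpoint b g) (Lconj eta a z) = Lprod (Lconj eta a z) (Lpoint b g) <->
  Lprod (Lpoint (a `&` b) (z * g * z^-1)%g) eta =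
  Lprod eta (Lpoint (a `&` b) (z * g * z^-1)%g).
Proof.
rewrite !(Lpoint_commP hL) /Lconj; split=> E y.
  have := E (z^-1 * y * z)%g.
  by rewrite !meetA ![b `&` a]meetC !invgM !invgK !mulgA mulgK mulgV mul1g.
have := E (z * y * z^-1)%g.
by rewrite !meetA ![b `&` a]meetC !invgM !invgK !mulgA !mulgVK.
Qed.

Lemma Lsubgroup_conj_le (d : Order.disp_t) (L : tbLatticeType d)
    (G : groupType) (mu : G -> L) (x y : G) :
  is_Lsubgroup mu -> mu x `&` mu y <= mu (x * y * x^-1)%g.
Proof.
move=> [muM muV]; apply: le_trans (muM _ _).
by rewrite muV lexI muM leIl.
Qed.

Theorem theorem4p4 (d : Order.disp_t) (L : tbLatticeType d) (G : groupType)
    (hL : complete_lattice L) (hcd : completely_distributive L)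
    (mu : G -> L) (hmu : is_Lsubgroup mu)
    (eta : G -> L) (heta : Lsubgroup_of mu eta)
    (a : L) (z : G) (haz : Lpoint_in a z mu) :
  forall g : G,
    Lconj (Lnormalizer mu eta) a z g =
    (a `&` Lnormalizer mu (Lconj eta a z) g)%O.
Proof.
move=> g; rewrite /Lconj -/(Lconj eta a z) !(LnormalizerE hL).
apply/le_anti/andP; split; apply: (meet_lsup_mono hL hcd) => b /= [bmu bE].
- split.
    (* As a conjugate by [z^-1], [g] satisfies [mu g >= mu z^-1 /\ mu (z * g * z^-1)], and
       [mu z^-1 = mu z >= a]. *)
    have -> : g = (z^-1 * (z * g * z^-1) * z^-1^-1)%g.
      by rewrite invgK !mulgA mulVg mul1g mulgVK.
    apply: le_trans (Lsubgroup_conj_le _ _ hmu); case: hmu => _ ->.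
    exact: leI2.
  (* The second factor [a] is absorbed by idempotence; lowering the height from [b] to the meet of
     [a] and [b] preserves commutation. *)
  apply/(Lpoint_comm_LconjP hL)/(Lpoint_commP hL) => y.
  by rewrite meetA meetxx -!meetA; congr (_ `&` _); move/(Lpoint_commP hL): bE.
- split; last exact/(Lpoint_comm_LconjP hL).
  exact: le_trans (leI2 haz bmu) (Lsubgroup_conj_le _ _ hmu).
Qed.
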